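(* Let $X$ be a Banach space, $\tau$ a Hausdorff linear topology on $X$, and $C\subset X$ a convex, bounded, $\tau$-compact set. Let $S$ be a semitopological semigroup which is left reversible or left amenable, and let $\{T_s:s\in S\}$ be a representation of $S$ on $C$ such that $S\times C\ni(s,x)\mapsto T_sx$ is jointly continuous ($C$ with $\tau$) and the family $\mathcal S=\{T_s:s\in S\}$ is (as a semigroup under composition) generated by averaged affine mappings. Then there exists an affine surjective mapping $r:C\to\mathrm{Fix}\,\mathcal S$ with $r\circ r=r$. If moreover $\mathcal S$ is locally $\tau$-equicontinuous, then $r$ can be chosen to be $\tau$-continuous as well.
   Context: An averaged affine mapping is one of the form $T=\alpha I+(1-\alpha)U$ with $\alpha\in(0,1)$ and $U:C\to C$ affine ($U(\lambda x+(1-\lambda)y)=\lambda Ux+(1-\lambda)Uy$ for $\lambda\in[0,1]$). Semitopological semigroup: Hausdorff topology making $s\mapsto ts$, $s\mapsto st$ continuous. Representation: $T_{st}=T_s\circ T_t$. Left reversible: any two closed right ideals intersect. Left amenable: there is $\mu\in LUC(S)^*$ with $\|\mu\|=\mu(1)=1$, $\mu(l_sf)=\mu(f)$, where $(l_sf)(t)=f(st)$ and $LUC(S)$ consists of bounded continuous $f$ with $s\mapsto l_sf$ sup-norm continuous. $\mathrm{Fix}\,\mathcal S$ is the set of common fixed points. Locally $\tau$-equicontinuous: for every $x_0\in C$ and every $\tau$-neighbourhood $B$ of $0$ there is a $\tau$-neighbourhood $V$ of $x_0$ with $T x-Ty\in B$ for all $T\in\mathcal S$ and $x,y\in V\cap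 C$. *)

(* Defs.v *)
From HB Require Import structures.
From mathcomp Require Import all_boot all_order all_algebra.
From mathcomp Require Import all_classical all_reals all_analysis.
Set Implicit Arguments. Unset Strict Implicit. Unset Printing Implicit Defensive.
Import Order.TTheory GRing.Theory Num.Theory.
Import numFieldNormedType.Exports.
Local Open Scope classical_set_scope.
Local Open Scope ring_scope.

Section Defs.
Variables (R : realType) (X : normedModType R).

Definition is_topology (O : set (set X)) : Prop :=
  [/\ O setT,
      (forall A B, O A -> O B -> O (A `&` B)) &
      (forall F : set (set X), F `<=` O -> O [set x | exists2 A, F A & A x])].

Definition is_hausdorff_top (O : set (set X)) : Prop :=
  forall x y : X, x <> y ->
    exists U V, [/\ O U, O V, U x, V y & U `&` V = set0].

Definition hausdorff_linear_topology (O : set (set X)) : Prop :=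
  [/\ is_topology O, is_hausdorff_top O,
      (forall (x y : X) U, O U -> U (x + y) ->
         exists V W, [/\ O V, O W, V x, W y &
           forall a b, V a -> W b -> U (a + b)]) &
      (forall (c : R) (x : X) U, O U -> U (c *: x) ->
         exists2 d : R, 0 < d & exists V, [/\ O V, V x &
           forall (c' : R) z, `|c' - c| < d -> V z -> U (c' *: z)])].

Definition tau_nbhd (O : set (set X)) (x : X) (A : set X) : Prop :=
  exists U, [/\ O U, U x & U `<=` A].

Definition tau_compact (O : set (set X)) (C : set X) : Prop :=
  forall F : set (set X), F `<=` O ->
    C `<=` [set x | exists2 A, F A & A x] ->
    exists G : set (set X), [/\ finite_set G, G `<=` F &
      C `<=` [set x | exists2 A, G A & A x]].

Definition convex_subset (C : set X) : Prop :=
  forall x y (l : R), C x -> C y -> 0 <= l <= 1 -> C (l *: x + (1 - l) *: y).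

Definition norm_bounded (C : set X) : Prop :=
  exists M : R, forall x, C x -> `|x| <= M.

Definition maps_into (C D : set X) (f : X -> X) : Prop :=
  forall x, C x -> D (f x).

Definition affine_on (C : set X) (f : X -> X) : Prop :=
  forall x y (l : R), C x -> C y -> 0 <= l <= 1 ->
    f (l *: x + (1 - l) *: y) = l *: f x + (1 - l) *: f y.

Definition averaged_affine (C : set X) (T : X -> X) : Prop :=
  exists (a : R) (U : X -> X), [/\ 0 < a < 1, maps_into C C U, affine_on C U &
    forall x, C x -> T x = a *: x + (1 - a) *: U x].

Fixpoint all_in (G : set (X -> X)) (l : seq (X -> X)) : Prop :=
  match l with nil => True | g :: l' => G g /\ all_in G l' end.

Definition comp_list (l : seq (X -> X)) : X -> X := foldr (fun g h => g \o h) id l.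

Definition tau_continuous_on (O : set (set X)) (C : set X) (f : X -> X) : Prop :=
  forall x U, C x -> O U -> U (f x) ->
    exists V, [/\ O V, V x & forall y, C y -> V y -> U (f y)].
End Defs.

Section Semigroup.
Variables (R : realType) (S : topologicalType) (mul : S -> S -> S).

Definition semitopological_semigroup : Prop :=
  [/\ associative mul, hausdorff_space S,
      (forall t, continuous (fun s => mul t s)) &
      (forall t, continuous (fun s => mul s t))].

Definition right_ideal (I : set S) : Prop :=
  I !=set0 /\ forall s t, I s -> I (mul s t).

Definition left_reversible : Prop :=
  forall I J, closed I -> right_ideal I -> closed J -> right_ideal J ->
    I `&` J !=set0.

Definition LUC (f : S -> R) : Prop :=
  [/\ exists M : R, forall t, `|f t| <= M,
      continuous f &
      forall s (e : R), 0 < e ->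
        \forall t \near s, forall u, `|f (mul t u) - f (mul s u)| <= e].

(** a left invariant mean on LUC(S): a linear functional of norm 1 with
    mu(1) = 1 (norm <= 1 together with mu(1)=1 gives norm exactly 1). *)
Definition left_amenable : Prop :=
  exists mu : (S -> R) -> R,
    [/\ (forall f g (a b : R), LUC f -> LUC g ->
           mu (fun t => a * f t + b * g t) = a * mu f + b * mu g),
        (forall f (M : R), LUC f -> (forall t, `|f t| <= M) -> `|mu f| <= M),
        mu (fun _ => 1) = 1 &
        (forall s f, LUC f -> mu (fun t => f (mul s t)) = mu f)].
End Semigroup.

(* Main.v *)
(** Every [T s] is a composition of averaged affine maps, hence itself of the
    form [a I + (1 - a) U].  Then [T^n x] is the mean of [U^k x] for the
    binomial law of parameters [n] and [1 - a], and Stein's identity together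
    with the variance of that law gives [T^n x - T^(n+1) x = d (c - c')] with
    [c], [c'] in [C] and [d] arbitrarily small, uniformly in [x].  As [C] is
    bounded, a point lying in [T^n C] for all [n] is fixed by [T].

    The semigroup acts by composition on the compact Hausdorff space of maps
    [C -> C] with pointwise [tau]-convergence, and preserves the closure [L] of
    [{T_s}].  The sets [T_s L] have a common point [r]: for a reversible
    semigroup they are directed downwards; for an amenable one, the mean of an
    orbit function [t |-> h (T_t y)] vanishes as soon as [h = 0] on some
    [T_s L], so finitely many complements of such sets cannot cover [L].  By
    the first part [r] takes its values in the common fixed points, and, being
    a pointwise limit of the [T_s], it is affine and fixes them. *)
Require Import Defs.
From HB Require Import structures.
From mathcomp Require Import all_boot all_order all_algebra.
From mathcomp Require Import all_classical all_reals all_analysis.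
From mathcomp Require Import ring lra.
Import Order.TTheory GRing.Theory Num.Theory.
Import numFieldNormedType.Exports.
Local Open Scope classical_set_scope.
Local Open Scope ring_scope.
Set Implicit Arguments.
Unset Strict Implicit.
Unset Printing Implicit Defensive.

(** * Means with respect to the binomial law *)

Section BinomialMean.
Variables (R : realType) (a : R).

(** Expectation of [g k] for [k] binomial with parameters [n] and [1 - a]. Conditioning on one trial
    avoids binomial coefficients and matches repeated application of [a I + (1 - a) U]. *)
Fixpoint binomial_mean (V : lmodType R) (n : nat) (g : nat -> V) : V :=
  if n is m.+1
  then a *: binomial_mean m g + (1 - a) *: binomial_mean m (g \o succn)
  else g 0%N.

Lemma binomial_meanS (V : lmodType R) n (g : nat -> V) :
  binomial_mean n.+1 g =
  a *: binomial_mean n g + (1 - a) *: binomial_mean n (g \o succn).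
Proof. by []. Qed.

Lemma binomial_mean_linear (V : lmodType R) n c (g h : nat -> V) :
  binomial_mean n (fun k => c *: g k + h k) =
  c *: binomial_mean n g + binomial_mean n h.
Proof.
elim: n g h => [//|n IH] g h; rewrite !binomial_meanS IH.
rewrite (_ : (fun k => c *: g k + h k) \o succn =
  fun k => c *: (g \o succn) k + (h \o succn) k) // IH.
rewrite !scalerDr !scalerA ![c * _]mulrC.
by rewrite -!addrA; congr (_ + _); rewrite addrCA.
Qed.

Lemma binomial_mean_cst (V : lmodType R) n (v : V) :
  binomial_mean n (fun=> v) = v.
Proof.
elim: n => [//|n IH]; rewrite binomial_meanS.
rewrite (_ : (fun=> v) \o succn = fun=> v) // IH -scalerDl.
by rewrite addrCA subrr addr0 scale1r.
Qed.

Lemma binomial_meanZ (V : lmodType R) n c (g : nat -> V) :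
  binomial_mean n (fun k => c *: g k) = c *: binomial_mean n g.
Proof.
have := binomial_mean_linear n c g (fun=> 0).
rewrite binomial_mean_cst addr0 => <-; congr (binomial_mean n _).
by apply/funext => k; rewrite addr0.
Qed.

Lemma binomial_meanD (V : lmodType R) n (g h : nat -> V) :
  binomial_mean n (fun k => g k + h k) = binomial_mean n g + binomial_mean n h.
Proof.
rewrite -[binomial_mean n g]scale1r -binomial_mean_linear.
by congr (binomial_mean n _); apply/funext => k; rewrite scale1r.
Qed.

Lemma binomial_meanB (V : lmodType R) n (g h : nat -> V) :
  binomial_mean n (fun k => g k - h k) = binomial_mean n g - binomial_mean n h.
Proof.
rewrite -[- binomial_mean n h]scaleN1r addrC -binomial_mean_linear.
by congr (binomial_mean n _); apply/funext => k; rewrite scaleN1r addrC.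
Qed.

(** The absorption identity k C(n+1,k) = (n+1) C(n,k-1), in the form of a mean. *)
Lemma binomial_mean_natZ (V : lmodType R) n (g : nat -> V) :
  binomial_mean n.+1 (fun k => k%:R *: g k) =
  (n.+1%:R * (1 - a)) *: binomial_mean n (g \o succn).
Proof.
elim: n g => [|n IH] g.
  by rewrite /= scale0r scaler0 add0r scale1r mul1r.
rewrite binomial_meanS IH.
rewrite (_ : (fun k => k%:R *: g k) \o succn =
    fun k => (k%:R *: (g \o succn) k) + (g \o succn) k); last first.
  by apply/funext => k; rewrite [LHS]/comp -natr1 scalerDl scale1r.
rewrite binomial_meanD IH scalerDr addrA -[n.+2%:R]natr1 mulrDl mul1r.
set c : R := n.+1%:R * (1 - a).
rewrite ![_ *: (c *: _)]scalerA ![_ * c]mulrC -![(c * _) *: _]scalerA -scalerDr.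
by rewrite -binomial_meanS -scalerDl.
Qed.

(* Stein's identity for the binomial law: summation by parts trades the
   discrete derivative of [g] for the centered weight [N (1 - a) - k]. *)
Lemma binomial_mean_centered (V : lmodType R) n (g : nat -> V) :
  binomial_mean n.+1 (fun k => (n.+1%:R * (1 - a) - k%:R) *: g k) =
  (n.+1%:R * (1 - a) * a) *: binomial_mean n (fun k => g k - g k.+1).
Proof.
rewrite (_ : (fun k => _) =
  fun k => (n.+1%:R * (1 - a)) *: g k - k%:R *: g k); last first.
  by apply/funext => k; rewrite scalerBl.
rewrite !binomial_meanB binomial_meanZ binomial_mean_natZ -scalerBr -[(_ * a) *: _]scalerA.
congr (_ *: _); rewrite binomial_meanS scalerBr -addrA.
by congr (_ + _); rewrite scalerBl scale1r addrAC subrr add0r.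
Qed.

Hypothesis a01 : 0 < a < 1.

Lemma binomial_mean_ge0 n (w : nat -> R^o) :
  (forall k, 0 <= w k) -> 0 <= binomial_mean n w :> R.
Proof.
elim: n w => [|n IH] w w0; [exact: w0|rewrite binomial_meanS].
have [/andP[a0 a1]] := a01.
apply: addr_ge0; apply: mulr_ge0; rewrite ?subr_ge0 ?(ltW a0) ?(ltW a1) //.
  exact: IH.
by apply: IH => k; apply: w0.
Qed.

Lemma binomial_mean_le n (v w : nat -> R^o) :
  (forall k, v k <= w k) -> (binomial_mean n v : R) <= binomial_mean n w.
Proof.
move=> vw; rewrite -subr_ge0 -binomial_meanB.
by apply: binomial_mean_ge0 => k; rewrite subr_ge0.
Qed.

(** Stein's identity for the centered weight itself, whose discrete derivative is constantly 1. *)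
Lemma binomial_mean_variance n :
  binomial_mean n.+1
    (fun k => (n.+1%:R * (1 - a) - k%:R) ^+ 2 : R^o) =
  n.+1%:R * (1 - a) * a.
Proof.
have := binomial_mean_centered n
  (fun k => n.+1%:R * (1 - a) - k%:R : R^o).
rewrite (_ : (fun k => _ - _ - (_ - _)) = fun=> 1); last first.
  by apply/funext => k; rewrite -natr1; ring.
by rewrite binomial_mean_cst => E; rewrite -[RHS]mulr1 -[RHS]E.
Qed.

(** The point [c] is the barycentre; the total mass is kept as a factor so that it may vanish. *)
Lemma convex_binomial_mean (X : normedModType R) (C : set X) n
    (w : nat -> R^o) (g : nat -> X) :
  convex_subset C -> (forall k, 0 <= w k) -> (forall k, C (g k)) ->
  exists2 c, C c & binomial_mean n (fun k => w k *: g k) =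
    (binomial_mean n w : R) *: c.
Proof.
move=> cC; elim: n w g => [|n IH] w g w0 gC; first by exists (g 0%N).
have [c1 Cc1 E1] := IH w g w0 gC.
have [c2 Cc2 E2] := IH (w \o succn) (g \o succn)
  (fun k => w0 k.+1) (fun k => gC k.+1).
have l1 := @binomial_mean_ge0 n w w0.
have l2 := @binomial_mean_ge0 n (w \o succn) (fun k => w0 k.+1).
rewrite !binomial_meanS E1.
rewrite (_ : (fun k => w k *: g k) \o succn =
  fun k => (w \o succn) k *: (g \o succn) k) // E2.
set s1 : R := binomial_mean n w in l1 *.
set s2 : R := binomial_mean n (w \o succn) in l2 *.
rewrite -[a *: binomial_mean n w + _]/(a * s1 + (1 - a) * s2) !scalerA.
have /andP[a0 a1] := a01.
have p1 : 0 <= a * s1 by apply: mulr_ge0 => //; apply: ltW.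
have p2 : 0 <= (1 - a) * s2 by apply: mulr_ge0; rewrite // subr_ge0 ltW.
have [s0|s0] := eqVneq (a * s1 + (1 - a) * s2) 0.
  exists c1 => //; move/eqP: (s0); rewrite paddr_eq0 // => /andP[/eqP-> /eqP->].
  by rewrite addr0 !scale0r addr0.
have sp : 0 < a * s1 + (1 - a) * s2 by rewrite lt_def s0 addr_ge0.
set s := a * s1 + _ in s0 sp *.
exists ((a * s1 / s) *: c1 + (1 - a * s1 / s) *: c2).
  apply: cC => //; apply/andP; split; first by rewrite divr_ge0 // ltW.
  by rewrite ler_pdivrMr // mul1r /s lerDl.
rewrite scalerDr !scalerA; congr (_ *: _ + _ *: _); last first.
  by rewrite mulrBr mulr1 mulrCA divff // mulr1 /s addrAC subrr add0r.
by rewrite mulrCA divff // mulr1.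
Qed.

End BinomialMean.

(** * Averaged affine maps: asymptotic regularity and composition *)

Section Averaged.
Variables (R : realType) (X : normedModType R) (C : set X).
Hypothesis cC : convex_subset C.

Lemma iter_maps_into (f : X -> X) n : maps_into C C f -> maps_into C C (iter n f).
Proof. by move=> fC x Cx; elim: n => //= n; apply: fC. Qed.

(** Being affine, [U] commutes with binomial means, so one more [T] is one more trial. *)
Lemma iter_averaged (a : R) (T U : X -> X) n x :
  0 < a < 1 -> maps_into C C U -> affine_on C U ->
  (forall x, C x -> T x = a *: x + (1 - a) *: U x) -> C x ->
  iter n T x = binomial_mean a n (fun k => iter k U x).
Proof.
move=> a01 UC Uaff TE Cx.
have /andP[/ltW a0 /ltW a1] := a01.
have meanC m (g : nat -> X) : (forall k, C (g k)) -> C (binomial_mean a m g).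
  elim: m g => [|m IH] g gC; [exact: gC|rewrite binomial_meanS; apply: cC].
  - exact: IH.
  - by apply: IH => k; apply: gC.
  - by rewrite a0.
have meanU m (g : nat -> X) : (forall k, C (g k)) ->
    U (binomial_mean a m g) = binomial_mean a m (U \o g).
  elim: m g => [//|m IH] g gC; rewrite !binomial_meanS Uaff ?a0 //.
  - by rewrite (IH g gC) (IH (g \o succn) (fun k => gC k.+1)).
  - exact: meanC.
  - by apply: meanC => k; apply: gC.
have oC k : C (iter k U x) by apply: iter_maps_into.
elim: n => [//|n IH].
rewrite iterS IH TE; last exact: meanC.
by rewrite meanU.
Qed.

(** By Stein's identity the difference is [(1 - a) / s] times the mean of [w k *: g k], where [w] is
    centered with variance [s]. The positive and negative parts of [w] have the same mean [l], so
    [d] is [(1 - a) * (l / s)]; a quadratic bound on [w] gives [l <= e * s] for an [n] independent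
    of [x]. *)
Lemma averaged_asymptotic_regularity (T : X -> X) (e : R) :
  averaged_affine C T -> 0 < e ->
  exists n, forall x, C x -> exists (d : R) c c',
    [/\ 0 <= d <= e, C c, C c' & iter n T x - iter n.+1 T x = d *: (c - c')].
Proof.
move=> [a [U [a01 UC Uaff TE]]] e0.
have /andP[a0 a1] := a01.
have p0 : 0 < 1 - a by rewrite subr_gt0.
(* Chosen so that [e / 2 * w k ^+ 2 - 2 * w k + b] is [b] times a perfect square. *)
pose b := 2 / e.
have b0 : 0 < b by apply: divr_gt0.
have pa : 0 < (1 - a) * a by apply: mulr_gt0.
(* This size of [n] makes [b] at most half of [e * s]. *)
pose n := Num.truncn (2 * b / (e * ((1 - a) * a))).
have nlt : 2 * b / (e * ((1 - a) * a)) < n.+1%:R.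
  by rewrite /n; apply: truncnS_gt.
exists n => x Cx.
pose g k := iter k U x.
have gC k : C (g k) by apply: iter_maps_into.
pose s : R := n.+1%:R * (1 - a) * a.
have s0 : 0 < s by rewrite /s -mulrA mulr_gt0.
pose w k : R := n.+1%:R * (1 - a) - k%:R.
pose wp k : R^o := Num.max (w k) 0.
pose wn k : R^o := Num.max (- w k) 0.
have wE k : w k = wp k - wn k.
  by rewrite /wp /wn; case: leP => ?; case: leP => ?; lra.
have wp0 k : 0 <= wp k by rewrite /wp le_max lexx orbT.
have wn0 k : 0 <= wn k by rewrite /wn le_max lexx orbT.
have [c Cc Ec] := convex_binomial_mean a01 n.+1 cC wp0 gC.
have [c' Cc' Ec'] := convex_binomial_mean a01 n.+1 cC wn0 gC.
pose l : R := binomial_mean a n.+1 wp.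
(* The weight [w] has mean zero: in Stein's identity the derivative of a constant vanishes. *)
have lE : l = binomial_mean a n.+1 wn.
  apply/eqP; rewrite -subr_eq0 -binomial_meanB.
  rewrite (_ : (fun k => _) = fun k => (w k) *: (1 : R^o)); last first.
    by apply/funext => k; rewrite -wE [RHS]mulr1.
  rewrite binomial_mean_centered subrr.
  by rewrite binomial_mean_cst scaler0.
have l0 : 0 <= l by apply: binomial_mean_ge0.
have le_s : l <= e * s.
  have : l <= binomial_mean a n.+1 (fun k => (e/2) *: (w k ^+ 2 : R^o) + b).
    apply: binomial_mean_le => // k; rewrite /wp ge_max.
    have be : b * (e / 2) = 1 by rewrite /b; field; lra.
    have h0 : 0 < e / 2 by apply: divr_gt0.
    rewrite -[(e/2) *: (_ : R^o)]/((e/2) * w k ^+ 2).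
    have sq : 0 <= b * (e / 2 * w k - 1) ^+ 2 by rewrite mulr_ge0 ?sqr_ge0 ?ltW.
    have sqE : b * (e / 2 * w k - 1) ^+ 2 = e / 2 * w k ^+ 2 - 2 * w k + b.
      transitivity (b * (e / 2) * (e / 2 * w k ^+ 2) - 2 * (b * (e / 2)) * w k + b).
        by ring.
      by rewrite be; ring.
    have hw : 0 <= e / 2 * w k ^+ 2 by rewrite mulr_ge0 ?sqr_ge0 ?ltW.
    by apply/andP; split; lra.
  rewrite binomial_mean_linear binomial_mean_cst binomial_mean_variance.
  move=> /le_trans; apply.
  rewrite -[(e/2) *: (_ : R^o)]/((e/2) * s).
  have : b <= (e/2) * s.
    move: nlt; rewrite ltr_pdivrMr; last by apply: mulr_gt0.
    by rewrite /s; lra.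
  lra.
exists ((1 - a) * (l / s)), c, c'; split => //.
  have q0 : 0 <= l / s by rewrite divr_ge0 // ltW.
  have q1 : l / s <= e by rewrite ler_pdivrMr.
  by apply/andP; split; nra.
rewrite !(@iter_averaged a T U) // -/g.
rewrite binomial_meanS.
rewrite (_ : _ - _ = (1 - a) *: binomial_mean a n (fun k => g k - g k.+1)).
  rewrite -scalerA; congr (_ *: _).
  apply: (@scalerI _ _ s); first by rewrite gt_eqF.
  rewrite -binomial_mean_centered -/w scalerA mulrCA divff ?gt_eqF // mulr1.
  rewrite scalerBr {2}lE -Ec -Ec' -binomial_meanB.
  by congr binomial_mean; apply/funext => k; rewrite -/(w k) wE scalerBl.
rewrite binomial_meanB opprD addrA scalerBr; congr (_ + _).
by rewrite scalerBl scale1r.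
Qed.

(** If [T^n y = x], then [x - T x] is [T^n y - T^(n+1) y], whose norm is arbitrarily small by
    asymptotic regularity and boundedness. *)
Lemma averaged_fixed (T : X -> X) x :
  norm_bounded C -> maps_into C C T -> averaged_affine C T ->
  (forall n, exists2 y, C y & iter n T y = x) -> T x = x.
Proof.
move=> [M CM] TC avT xT; apply/eqP; rewrite eq_sym -subr_eq0 -normr_eq0.
rewrite eq_le normr_ge0 andbT; apply/ler_addgt0Pl => e e0; rewrite addr0.
have M0 : 0 <= M by have [y /CM My _] := xT 0%N; apply: le_trans My.
have d0 : 0 < e / (2 * M + 1) by apply: divr_gt0 => //; lra.
have [n /(_ _ _)] := averaged_asymptotic_regularity avT d0.
have [y Cy yx] := xT n => /(_ _ Cy)[d [c [c' [/andP[d1 d2] Cc Cc' E]]]].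
move: E; rewrite iterS yx => ->; rewrite normrZ ger0_norm //.
apply: (@le_trans _ _ (e / (2 * M + 1) * (2 * M + 1))); last first.
  by rewrite divfK //; lra.
apply: ler_pM => //; apply: (le_trans (ler_normB _ _)).
by have := CM _ Cc; have := CM _ Cc'; lra.
Qed.

Lemma averaged_comp (T1 T2 : X -> X) :
  averaged_affine C T1 -> averaged_affine C T2 -> averaged_affine C (T1 \o T2).
Proof.
move=> [a1 [U1 [/andP[a10 a11] U1C aU1 E1]]] [a2 [U2 [/andP[a20 a21] U2C aU2 E2]]].
have T2C x : C x -> C (T2 x).
  by move=> Cx; rewrite E2 //; apply: cC; rewrite ?ltW //; apply: U2C.
have aT2 : affine_on C T2.
  move=> x y l Cx Cy l01; rewrite !E2 //; last exact: cC.
  rewrite aU2 // !scalerDr !scalerA !addrA; congr (_ + _); last first.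
    by rewrite mulrC.
  rewrite -!addrA; congr (_ + _); first by rewrite mulrC.
  by rewrite addrC; congr (_ + _); rewrite mulrC.
have q0 : 0 < a1 * a2 by apply: mulr_gt0.
have q1 : a1 * a2 < 1 by nra.
(* Expanding gives [a1 a2 x + a1 (1 - a2) U2 x + (1 - a1) U1 (T2 x)]; [l] is the normalised weight
   of the middle term. *)
pose l := a1 * (1 - a2) / (1 - a1 * a2).
have nz : 1 - a1 * a2 != 0 by lra.
have l01 : 0 <= l <= 1.
  have h : 0 < 1 - a1 * a2 by lra.
  apply/andP; split; first by rewrite divr_ge0 //; nra.
  by rewrite ler_pdivrMr //; nra.
exists (a1 * a2), (fun x => l *: U2 x + (1 - l) *: U1 (T2 x)); split.
- by rewrite q0.
- by move=> x Cx; apply: cC => //; [apply: U2C | apply/U1C/T2C].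
- move=> x y m Cx Cy m01.
  rewrite aU2 // aT2 // aU1 //; try exact: T2C.
  rewrite !scalerDr !scalerA !(mulrC m) !(mulrC (1 - m)).
  by rewrite -!addrA; congr (_ + _); rewrite addrCA.
- move=> x Cx /=; rewrite E1; last exact: T2C.
  rewrite {1}E2 // !scalerDr !scalerA -addrA; congr (_ + (_ *: _ + _ *: _)).
    by rewrite /l; field.
  by rewrite /l; field.
Qed.

Lemma averaged_affine_on (T : X -> X) : averaged_affine C T -> affine_on C T.
Proof.
move=> [a [U [a01 UC aU E]]] x y l Cx Cy l01; rewrite !E //; last exact: cC.
rewrite aU // !scalerDr !scalerA !(mulrC a) !(mulrC (1 - a)).
by rewrite -!addrA; congr (_ + _); rewrite addrCA.
Qed.

Lemma averaged_comp_list (G : set (X -> X)) l :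
  (forall g, G g -> averaged_affine C g) -> all_in G l ->
  averaged_affine C (comp_list l).
Proof.
move=> avG; elim: l => [_|g l IH /= [Gg Gl]].
  exists (1/2), id; split=> //; first by lra.
  by move=> x _; rewrite -scalerDl addrCA subrr addr0 scale1r.
exact: averaged_comp (avG _ Gg) (IH Gl).
Qed.

End Averaged.

(** A covering principle for an ideal [J] of sets: if [K] were not in [J], the sets whose complement
    in [K] lies in [J] would form a proper filter, and a cluster point of it would contradict local
    membership. *)
Lemma compact_ideal (T : topologicalType) (K : set T) (J : set (set T)) :
  compact K -> J set0 ->
  (forall A B, A `<=` B -> J B -> J A) ->
  (forall A B, J A -> J B -> J (A `|` B)) ->
  (forall x, K x -> exists2 A, nbhs x A & J (A `&` K)) -> J K.
Proof.
move=> cK J0 JS JU Jloc; apply: contrapT => nJK.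
pose F : set_system T := [set A | J (K `\` A)].
have FF : Filter F.
  split => /=.
  - by rewrite /F /= setDT.
  - by move=> A B FA FB; rewrite /F /= setDIr; apply: JU.
  - by move=> A B AB; apply: JS => x [Kx nB]; split=> // /AB.
have PF : ProperFilter F by split=> // F0; apply: nJK; move: F0; rewrite /F /= setD0.
have [x [Kx clx]] := cK F PF (eq_ind_r J J0 (setDv K)).
have [A nA JA] := Jloc _ Kx.
have [|y [nAy Ay]] := clx (~` A) A _ nA => //.
by apply: JS JA => z [Kz /contrapT Az].
Qed.

(** * Semigroup actions on a compact Hausdorff space *)

Section Action.
Variables (R : realType) (S P : topologicalType) (mul : S -> S -> S).
Variables (act : S -> P -> P) (L : set P).
Hypotheses (cptP : compact [set: P]) (hsdP : hausdorff_space P).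
Hypothesis act_cont : continuous (fun p : S * P => act p.1 p.2).
Hypothesis actM : forall s t y, act (mul s t) y = act s (act t y).
Hypotheses (clL : closed L) (actL : forall s y, L y -> L (act s y)).

Lemma act_continuousr s : continuous (act s).
Proof.
move=> y; apply: (@continuous_comp _ _ _ (fun z => (s, z)) (fun p => act p.1 p.2)).
  by apply: cvg_pair; [exact: cvg_cst | exact: cvg_id].
exact: act_cont.
Qed.

Lemma act_continuousl y : continuous (act^~ y).
Proof.
move=> s; apply: (@continuous_comp _ _ _ (fun t => (t, y)) (fun p => act p.1 p.2)).
  by apply: cvg_pair; [exact: cvg_id | exact: cvg_cst].
exact: act_cont.
Qed.

Lemma act_image_closed s : closed (act s @` L).
Proof.
apply: compact_closed => //; apply: continuous_compact.
  by apply: continuous_subspaceT; apply: act_continuousr.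
exact: subclosed_compact clL cptP _.
Qed.

(** Sets that miss some image of [L] form an ideal, since by reversibility any two images contain a
    third. Without a common point, closedness of the images makes [L] locally in this ideal; then
    [L] would miss an image that is a nonempty part of it. *)
Lemma reversible_act_images y0 :
  (forall t, continuous (fun s => mul s t)) -> associative mul ->
  left_reversible mul -> L y0 ->
  exists2 y, L y & forall s, (act s @` L) y.
Proof.
move=> mulc mulA rev Ly0.
have [s0|S0] := pselect (exists s : S, True); last first.
  by exists y0 => // s; case: S0; exists s.
have {s0} [s0 _] := s0.
apply: contrapT => noy.
pose J (A : set P) := exists s, forall y, A y -> ~ (act s @` L) y.
have : J L; last first.
  by move=> [s /(_ (act s y0))]; apply; [exact: actL | exists y0].
(* Reversibility speaks of closed ideals; continuity of right translations keeps the closure a right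
   ideal. *)
pose I s := closure (range (mul s)).
have Iri s : right_ideal mul (I s).
  split; first by exists (mul s s); apply: subset_closure; exists s.
  move=> u t Iu B /mulc/Iu[_ [[v _ <-] Bv]].
  by exists (mul (mul s v) t); split=> //; exists (mul v t) => //; rewrite mulA.
(* Clear for [u] in the range of [mul s]; it passes to the closure since orbit maps are continuous
   and the image of [L] is closed. *)
have Isub s u y : I s u -> (act u @` L) y -> (act s @` L) y.
  move=> Iu [z Lz <-]; have cl := act_image_closed (s := s); apply: (cl (act u z)) => B.
  move=> /act_continuousl/Iu[_ [[v _ <-] Bv]].
  exists (act (mul s v) z); split=> //; rewrite actM.
  by exists (act v z) => //; apply: actL.
apply: compact_ideal (subclosed_compact clL cptP _) _ _ _ _ => //.
- by exists s0.
- by move=> A B AB [s sB]; exists s => y /AB/sB.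
- move=> A B [s sA] [t tB].
  have [u [Is It]] := rev (I s) (I t) (@closed_closure _ _) (Iri s)
    (@closed_closure _ _) (Iri t).
  exists u => y [/sA nA|/tB nB] uy; first exact/nA/(Isub _ _ _ Is uy).
  exact/nB/(Isub _ _ _ It uy).
- move=> y Ly; have [s nsy] : exists s, ~ (act s @` L) y.
    apply: contrapT => /forallNP sy; apply: noy.
    by exists y => // s; apply: contrapT.
  exists (~` (act s @` L)); last by exists s => z [].
  by apply: open_nbhs_nbhs; split=> //; rewrite openC; apply: act_image_closed.
Qed.

(** Uniformity in [u] comes from compactness: [h (act t y) - h (act s y)] is jointly continuous and
    vanishes at [t = s], so one neighbourhood of [s] serves for all [y], in particular for
    [act u y0]. *)
Lemma LUC_orbit (h : P -> R) (M : R) y0 :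
  continuous h -> (forall y, `|h y| <= M) ->
  LUC mul (fun t => h (act t y0)).
Proof.
move=> hc hM; split.
- by exists M.
- move=> s; apply: (@continuous_comp _ _ _ (act^~ y0) h); last exact: hc.
  exact: act_continuousl.
move=> s e e0.
have dc : continuous (fun p : S * P => h (act p.1 p.2) - h (act s p.2)).
  move=> p; apply: (@continuousB _ _ _ (fun p : S * P => h (act p.1 p.2))
      (fun p : S * P => h (act s p.2))).
    apply: (@continuous_comp _ _ _ (fun p : S * P => act p.1 p.2) h).
      exact: act_cont.
    exact: hc.
  apply: (@continuous_comp _ _ _ snd (h \o act s)); first exact: cvg_snd.
  by apply: continuous_comp; [exact: act_continuousr | exact: hc].
have /compact_near_coveringP/(_ S (nbhs s)
  (fun t y => `|h (act t y) - h (act s y)| <= e) _) cov := cptP.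
have : \forall t \near s, [set: P] `<=` fun y => `|h (act t y) - h (act s y)| <= e.
  apply: cov => y _.
  have /cvgrPdist_le/(_ e e0) := dc (s, y).
  rewrite /= subrr => -[[A B] /= [As By] AB].
  exists (B, A) => //= -[y' t] /= [By' At].
  by have := AB (t, y') (conj At By'); rewrite /= sub0r normrN.
by apply: filterS => t Pt u; rewrite !actM; apply: Pt.
Qed.

Lemma amenable_act_images y0 :
  left_amenable R mul -> L y0 -> exists2 y, L y & forall s, (act s @` L) y.
Proof.
move=> [mu [mulin munorm mu1 muinv]] Ly0.
apply: contrapT => noy.
(* [J] is the ideal of sets dominated by an orbit function of mean zero. *)
pose J (A : set P) := exists h : P -> R, exists M : R,
  [/\ continuous h, (forall y, 0 <= h y <= M), (forall y, A y -> 1 <= h y) &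
      mu (fun t => h (act t y0)) = 0].
have LUCh (h : P -> R) (M : R) : continuous h -> (forall y, 0 <= h y <= M) ->
    LUC mul (fun t => h (act t y0)).
  move=> hc hM; apply: (@LUC_orbit _ M) => // y; have /andP[h0 h1] := hM y.
  by rewrite ger0_norm.
have LUCcst (c : R) : LUC mul (fun=> c).
  split; first by exists `|c|.
  - by move=> x; apply: cvg_cst.
  - by move=> s e e0; apply: nearW => t u; rewrite subrr normr0 ltW.
have mu0 : mu (fun=> 0) = 0.
  by apply/eqP; rewrite -normr_le0; apply: munorm => // t; rewrite normr0.
have : J L; last first.
  move=> [h [M [hc hM h1 muh]]].
  (* On the orbit [0 <= M - h <= M - 1], so the mean is at most [M - 1], whereas linearity gives
     [M]. *)
  have M1 : `|mu (fun t => M * 1 + (-1) * h (act t y0))| <= M - 1.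
    apply: munorm.
      apply: (@LUC_orbit (fun y => M * 1 + -1 * h y) M).
        move=> y; apply: cvgD; first exact: cvg_cst.
        by apply: cvgM; [exact: cvg_cst | exact: hc].
      move=> y; have /andP[? ?] := hM y; rewrite ger0_norm; lra.
    move=> t; have Lt := h1 _ (actL t Ly0); have /andP[_ ?] := hM (act t y0).
    by rewrite ger0_norm; lra.
  move: M1; rewrite mulin //; last exact: LUCh hM.
  by rewrite mu1 muh mulr1 mulr0 addr0; have := ler_norm M; lra.
apply: compact_ideal (subclosed_compact clL cptP _) _ _ _ _ => //.
- exists (fun=> 0), 0; split=> // y; [exact: cvg_cst | by rewrite lexx].
- move=> A B AB [h [M [hc hM h1 muh]]]; exists h, M; split=> // y /AB.
  exact: h1.
- move=> A B [h [M [hc hM h1 muh]]] [g [N [gc gN g1 mug]]].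
  exists (fun y => 1 * h y + 1 * g y), (M + N); split.
  + move=> y; apply: cvgD; apply: cvgM; try exact: cvg_cst; [exact: hc|exact: gc].
  + by move=> y; have := hM y; have := gN y; lra.
  + move=> y AB; have := hM y; have := gN y.
    by case: AB => [/h1|/g1]; lra.
  + rewrite (mulin (fun t => h (act t y0)) (fun t => g (act t y0))).
    * by rewrite muh mug; lra.
    * exact: LUCh hM.
    * exact: LUCh gN.
- move=> y Ly; have [s nsy] : exists s, ~ (act s @` L) y.
    apply: contrapT => /forallNP sy; apply: noy.
    by exists y => // s; apply: contrapT.
  (* A Urysohn function, zero on the image and one at [y], is doubled so that it is at least 1 near
     [y]. *)
  have /normal_separatorP : normal_space P by apply: compact_normal.
  move=> /(_ R (act s @` L) [set y]) sep.
  have /(@uniform_separatorP _ R)[f [fc f01 f0 f1]] :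
      uniform_separator (act s @` L) [set y].
    apply: sep; first exact: act_image_closed.
      exact/accessible_closed_set1/hausdorff_accessible.
    by rewrite -subset0 => z [+ zy]; rewrite zy.
  have f01' z : 0 <= f z <= 1 by have := f01 (f z) (imageP _ I); rewrite /= in_itv.
  have gc : continuous (fun z => 2 * f z).
    by move=> z; apply: cvgM; [exact: cvg_cst | exact: fc].
  have gb z : 0 <= 2 * f z <= 2 by have := f01' z; lra.
  exists [set z | 1 <= 2 * f z].
    have /cvgrPdist_le/(_ 1 ltr01) := gc y.
    apply: filterS => z /=; have -> : f y = 1 by apply: f1; exists y.
    by rewrite ler_norml; lra.
  exists (fun z => 2 * f z), 2; split=> //; first by move=> z [].
  (* Left invariance moves the orbit into the image of [L] under [act s], where [f] vanishes. *)
  rewrite -(muinv s); last exact: LUCh gb.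
  rewrite -[RHS]mu0; congr mu; apply/funext => t; rewrite actM.
  have -> : f (act s (act t y0)) = 0.
    apply: f0; exists (act s (act t y0)) => //.
    by exists (act t y0) => //; apply: actL.
  by rewrite mulr0.
Qed.

End Action.

(** * Closures, subspaces and pointwise convergence *)

Lemma closure_equalizer (P Q : topologicalType) (u v : P -> Q) (A : set P) f :
  hausdorff_space Q -> {for f, continuous u} -> {for f, continuous v} ->
  (forall g, A g -> u g = v g) -> closure A f -> u f = v f.
Proof.
move=> hQ uc vc uv clf; apply: hQ => B D nB nD.
have uB : nbhs f (u @^-1` B) := uc _ nB.
have vD : nbhs f (v @^-1` D) := vc _ nD.
have [g [Ag [uBg vDg]]] := clf _ (filterI uB vD).
by exists (u g); split=> //; rewrite uv.
Qed.

Lemma compact_set_type (T : topologicalType) (A : set T) :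
  compact A -> compact [set: A].
Proof.
move=> cA F PF _.
have [x [Ax clx]] : A `&` cluster (set_val @ F) !=set0.
  apply: cA; apply: (filterS (P := setT) (F := F)); last exact: filterT.
  by move=> y _; apply: set_valP.
exists (exist _ x (mem_set Ax)); split=> // B D FB [_ [[W oW <-] Wx WD]].
have FB' : (set_val @ F) (set_val @` B).
  by apply: (filterS (F := F)) FB => z Bz; exists z.
have nW : nbhs x W by apply: open_nbhs_nbhs.
by have [_ [[z Bz <-] Wz]] := clx _ _ FB' nW; exists z; split=> //; apply: WD.
Qed.

Lemma hausdorff_set_type (T : topologicalType) (A : set T) :
  hausdorff_space T -> hausdorff_space A.
Proof.
move=> hT x y cxy; apply: val_inj; apply: hT => B D.
move=> /(@initial_continuous _ _ (@set_val _ A)) nB.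
move=> /(@initial_continuous _ _ (@set_val _ A)) nD.
by have [z [Bz Dz]] := cxy _ _ nB nD; exists (set_val z).
Qed.

Lemma cvg_ptws (I : Type) (Q : topologicalType) (T : Type) (F : set_system T)
    (u : T -> {ptws I -> Q}) (f : {ptws I -> Q}) :
  Filter F -> (forall i, u x i @[x --> F] --> f i) -> u @ F --> f.
Proof.
move=> FF uf; apply/cvg_sup => i B [_ [[W oW <-] Wf] WB].
have : \forall x \near F, W (u x i) by apply: uf; apply: open_nbhs_nbhs.
by apply: filterS => x Wx; apply: WB.
Qed.

(** A synonym of [X] that carries [tau] instead of the norm topology; the hypothesis is a parameter
    so that the structure can be built from it. *)
Definition tau_space (R : realType) (X : normedModType R) (tau : set (set X))
  (_ : hausdorff_linear_topology tau) : Type := X.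

(** * The linear topology as a topological structure *)

Section TauSpace.
Variables (R : realType) (X : normedModType R) (tau : set (set X)).
Hypothesis htau : hausdorff_linear_topology tau.
Let Y := tau_space htau.

Let tauT : tau setT.
Proof. by case: htau => -[]. Qed.

Let tauI : setI_closed tau.
Proof. by case: htau => -[_ tI _] _ _ _ A B; apply: tI. Qed.

Let tau_bigU (I : Type) (f : I -> set X) :
  (forall i, tau (f i)) -> tau (\bigcup_i f i).
Proof.
case: htau => -[_ _ tU] _ _ _ tf.
have -> : \bigcup_i f i = [set x | exists2 A, range f A & A x].
  apply/seteqP; split=> x /=; first by move=> [i _ fx]; exists (f i) => //; exists i.
  by move=> [_ [i _ <-] fx]; exists i.
by apply: tU => _ [i _ <-].
Qed.

HB.instance Definition _ := Choice.copy Y X.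
HB.instance Definition _ := isOpenTopological.Build Y tauT tauI tau_bigU.

Lemma tau_space_hausdorff : hausdorff_space Y.
Proof.
move=> x y cxy; apply: contrapT => nxy.
have [_ /(_ x y nxy)[U [V [oU oV Ux Vy UV0]]] _ _] := htau.
have nU : nbhs (x : Y) (U : set Y) by apply: open_nbhs_nbhs.
have nV : nbhs (y : Y) (V : set Y) by apply: open_nbhs_nbhs.
by have [z] := cxy _ _ nU nV; rewrite UV0.
Qed.

(** Without a cluster point in [C], the open sets whose complement is in the filter would cover [C],
    and a finite subcover would put the empty set in the filter. *)
Lemma tau_space_compact (C : set X) : tau_compact tau C -> compact (C : set Y).
Proof.
move=> cC F PF FC; apply: contrapT => ncl.
have [|x Cx|G [Gfin GF CG]] :=
    cC [set U | tau U /\ F (~` U)].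
- by move=> U [].
- have : ~ cluster F x by move=> clx; apply: ncl; exists x.
  move=> /existsNP [A /existsNP [B /not_implyP [FA /not_implyP [nB]]]] AB0.
  move: nB; rewrite nbhsE => -[U [oU Ux] UB].
  exists U => //; split=> //; apply: filterS FA => z Az Uz.
  by apply: AB0; exists z; split=> //; apply: UB.
have : F (C `&` \bigcap_(U in G) ~` U).
  apply: filterI => //; have /finite_fsetP[D GD] := Gfin; rewrite GD.
  by apply: filter_bigI => U DU; have /GF[] : G U by rewrite GD.
by move=> /filter_ex[x [/CG[U GU Ux] /(_ U GU)]]; apply.
Qed.

Lemma tau_add_continuous (T : Type) (F : set_system T) (u v : T -> Y) (x y : Y) :
  Filter F -> u @ F --> x -> v @ F --> y ->
  ((u z : X) + (v z : X) : Y) @[z --> F] --> ((x : X) + (y : X) : Y).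
Proof.
move=> FF ux vy B; rewrite nbhsE => -[U [oU Uxy] UB].
have [_ _ /(_ _ _ _ oU Uxy)[V [W [oV oW Vx Wy VW]]] _] := htau.
have uV : F (u @^-1` V) by apply: ux; apply: (@open_nbhs_nbhs Y).
have vW : F (v @^-1` W) by apply: vy; apply: (@open_nbhs_nbhs Y).
by apply: (filterS2 (F := F)) uV vW => z Vz Wz; apply: UB; apply: VW.
Qed.

Lemma tau_scale_continuous (T : Type) (F : set_system T) (u : T -> Y) (x : Y) (c : R) :
  Filter F -> u @ F --> x ->
  (c *: (u z : X) : Y) @[z --> F] --> (c *: (x : X) : Y).
Proof.
move=> FF ux B; rewrite nbhsE => -[U [oU Ux] UB].
have [_ _ _ /(_ _ _ _ oU Ux)[d d0 [V [oV Vx VU]]]] := htau.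
have uV : F (u @^-1` V) by apply: ux; apply: (@open_nbhs_nbhs Y).
by apply: (filterS (F := F)) uV => z Vz; apply: UB; apply: VU => //; rewrite subrr normr0.
Qed.

End TauSpace.

(** * The limit retraction and its continuity *)

Lemma representation_iter (X S : Type) (mul : S -> S -> S) (T : S -> X -> X)
    (C : set X) s n x :
  (forall s x, C x -> C (T s x)) ->
  (forall s t x, C x -> T (mul s t) x = T s (T t x)) -> C x ->
  T (iter n (mul s) s) x = iter n.+1 (T s) x.
Proof. by move=> TC TM Cx; elim: n => [//|n IH]; rewrite iterS TM // IH. Qed.

(** The last conclusion, that [r] is approximated by a single [T s] at two points at once, serves
    the continuity proof. *)
Lemma limit_retraction (R : realType) (X : normedModType R)
    (tau : set (set X)) (C : set X)
    (S : topologicalType) (mul : S -> S -> S) (T : S -> X -> X) (s0 : S) :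
  hausdorff_linear_topology tau ->
  convex_subset C -> norm_bounded C -> tau_compact tau C ->
  semitopological_semigroup mul ->
  left_reversible mul \/ left_amenable R mul ->
  (forall s, maps_into C C (T s)) ->
  (forall s t x, C x -> T (mul s t) x = T s (T t x)) ->
  (forall s x U, C x -> tau U -> U (T s x) ->
     exists2 A, nbhs s A &
       exists V, [/\ tau V, V x &
         forall t y, A t -> V y -> C y -> U (T t y)]) ->
  (forall s, averaged_affine C (T s)) ->
  exists r : X -> X, [/\ maps_into C [set x | C x /\ forall s, T s x = x] r,
    (forall x, C x -> (forall s, T s x = x) -> r x = x),
    affine_on C r &
    forall x y U W, C x -> C y -> tau U -> tau W -> U (r x) -> W (r y) ->
      exists s, U (T s x) /\ W (T s y)].
Proof.
move=> htau cC bC cptC [mulA hS _ mulc] revam TC TM Tcont avT.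
pose Y := tau_space htau.
pose CY : set Y := C.
pose inC x (Cx : C x) : CY := exist _ x (mem_set Cx).
have valC (x : CY) : C (set_val x) := set_valP x.
have valc : continuous (set_val : CY -> Y) by apply: initial_continuous.
pose Tc s (x : CY) : CY := inC _ (TC s _ (valC x)).
have Tcc : continuous (fun p : S * CY => Tc p.1 p.2).
  move=> [s x] B [_ [[U oU <-] Ux] UB].
  have [A nA [V [oV Vx AV]]] := Tcont s _ U (valC x) oU Ux.
  exists (A, set_val @^-1` V) => /=.
    split=> //; apply: valc; exact: (@open_nbhs_nbhs Y).
  by move=> [t y] /= [At Vy]; apply: UB; apply: AV.
pose P : topologicalType := {ptws CY -> CY}.
pose act s (f : P) : P := fun x => Tc s (f x).
have evc (x : CY) : continuous (fun f : P => f x) by move=> f; apply: proj_continuous.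
have actc : continuous (fun p : S * P => act p.1 p.2).
  move=> p; apply: cvg_ptws => x.
  apply: (@continuous_comp _ _ _ (fun p : S * P => (p.1, p.2 x)) (fun p => Tc p.1 p.2)).
    apply: (@cvg_pair _ _ _ (nbhs p) (nbhs p.1) (nbhs (p.2 x)) _ _ _ fst
      (fun q => q.2 x)); first exact: cvg_fst.
    apply: (@continuous_comp _ _ _ snd (fun f : P => f x)); first exact: cvg_snd.
    exact: evc.
  exact: Tcc.
have cptP : compact [set: P].
  have /compact_set_type cptCY : compact CY by apply: tau_space_compact.
  have := @tychonoff CY (fun=> CY) (fun=> setT) (fun=> cptCY).
  by congr compact; apply/seteqP; split.
have hP : hausdorff_space P.
  by apply: hausdorff_product => x; apply: hausdorff_set_type; apply: tau_space_hausdorff.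
have actM s t f : act (mul s t) f = act s (act t f).
  apply/funext => x; apply: val_inj => /=; exact: TM.
pose L : set P := closure (range (Tc : S -> P)).
have clL : closed L by apply: closed_closure.
have actL s f : L f -> L (act s f).
  move=> Lf B /(act_continuousr actc)/Lf[_ [[t _ <-] Bt]].
  exists (Tc (mul s t)); split; first by exists (mul s t).
  suff -> : Tc (mul s t) = act s (Tc t) by [].
  by apply/funext => x; apply: val_inj => /=; apply: TM.
have L0 : L (Tc s0) by apply: subset_closure; exists s0.
have [f Lf fim] : exists2 f, L f & forall s, (act s @` L) f.
  case: revam => [rev|am].
    exact: (reversible_act_images cptP hP actc actM clL actL mulc mulA rev L0).
  exact: (amenable_act_images cptP hP actc actM clL actL am L0).
(* Outside [C] the value is arbitrary, and [x] is taken. *)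
pose r x : X := if pselect (C x) is left Cx then set_val (f (inC _ Cx)) else x.
have rE x (Cx : C x) : r x = set_val (f (inC _ Cx)).
  by rewrite /r; case: pselect => // Cx'; congr (set_val (f _)); apply: val_inj.
have hY : hausdorff_space Y by apply: tau_space_hausdorff.
have evvc (x : CY) : continuous (fun g : P => set_val (g x) : Y).
  move=> g; apply: (@continuous_comp _ _ _ (fun g : P => g x) (set_val : CY -> Y)).
    exact: evc.
  exact: valc.
exists r; split.
- move=> x Cx /=; rewrite rE; split; first exact: valC.
  (* Exponent 0 is trivial; for [n.+1], [iter n (mul s) s] is the power s^(n+1), and [f] lies in the
     image of [L] under it. *)
  move=> s; apply: (@averaged_fixed _ _ C) => // -[|n].
    by exists (set_val (f (inC x Cx))).
  have [z _ zf] := fim (iter n (mul s) s).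
  exists (set_val (z (inC x Cx))); first exact: valC.
  by rewrite -(representation_iter s n TC TM (valC _)) -zf.
- move=> x Cx Fx; rewrite rE.
  apply: (closure_equalizer (u := fun g : P => set_val (g (inC x Cx)) : Y) (v := fun=> x : Y)
    hY _ _ _ Lf).
  + exact: evvc.
  + exact: (@cst_continuous P Y).
  + by move=> _ [s _ <-]; apply: Fx.
- move=> x y l Cx Cy l01.
  have Cz := cC _ _ _ Cx Cy l01; rewrite !rE.
  (* Both sides are continuous in [g] because [tau] is linear, and they agree on the affine maps
     [T s]. *)
  apply: (closure_equalizer (u := fun g : P => set_val (g (inC _ Cz)) : Y)
    (v := fun g : P => l *: (set_val (g (inC x Cx)) : X) +
      (1 - l) *: (set_val (g (inC y Cy)) : X) : Y) hY _ _ _ Lf).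
  + exact: evvc.
  + apply: (@tau_add_continuous _ _ _ htau P (nbhs f)).
    * exact: (@tau_scale_continuous _ _ _ htau P (nbhs f) _ _ _ _ (evvc _ f)).
    * exact: (@tau_scale_continuous _ _ _ htau P (nbhs f) _ _ _ _ (evvc _ f)).
  + by move=> _ [s _ <-]; apply: (averaged_affine_on cC (avT s)).
- move=> x y U W Cx Cy oU oW; rewrite !rE => Ux Wy.
  have nU : nbhs f [set g : P | U (set_val (g (inC x Cx)))].
    by apply: evvc; apply: (@open_nbhs_nbhs Y).
  have nW : nbhs f [set g : P | W (set_val (g (inC y Cy)))].
    by apply: evvc; apply: (@open_nbhs_nbhs Y).
  by have [_ [[s _ <-] [Us Ws]]] := Lf _ (filterI nU nW); exists s.
Qed.

(** Write [r y] as [T s x + (T s y - T s x) + (r y - T s y)]. Equicontinuity controls the middle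
    term uniformly in [s], so [s] may be chosen last, depending on [y], to bring [T s x] near [r x]
    and [T s y] near [r y]. *)
Lemma equicontinuous_limit_continuous (R : realType) (X : normedModType R)
    (tau : set (set X)) (C : set X) (I : Type) (T : I -> X -> X) (r : X -> X) :
  hausdorff_linear_topology tau ->
  (forall x0 B, C x0 -> tau_nbhd tau 0 B ->
     exists V, tau_nbhd tau x0 V /\
       forall s x y, V x -> C x -> V y -> C y -> B (T s x - T s y)) ->
  (forall x y U W, C x -> C y -> tau U -> tau W -> U (r x) -> W (r y) ->
     exists s, U (T s x) /\ W (T s y)) ->
  tau_continuous_on tau C r.
Proof.
move=> htau eqc lim x U Cx oU Ux.
have [_ _ addc scalec] := htau.
have [V1 [W1 [oV1 oW1 V1x W10 VWU]]] : exists V W, [/\ tau V, tau W, V (r x), W 0 &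
    forall a b, V a -> W b -> U (a + b)] by apply: addc => //; rewrite addr0.
have [V2 [W2 [oV2 oW2 V20 W20 VW2]]] : exists V W, [/\ tau V, tau W, V 0, W 0 &
    forall a b, V a -> W b -> W1 (a + b)] by apply: addc => //; rewrite addr0.
have [V [[V' [oV' V'x V'V] VB]]] := eqc x V2 Cx (ex_intro _ V2 (And3 oV2 V20 (fun _ => id))).
exists V'; split=> // y Cy V'y.
(* The aim is a neighbourhood [N] of [r y] with [r y - z] in [W2] for all [z] in [N]. *)
have [W3 [V3 [oW3 oV3 W3r V30 WV3]]] : exists V W, [/\ tau V, tau W, V (r y), W (- r y) &
    forall a b, V a -> W b -> W2 (a + b)] by apply: addc => //; rewrite subrr.
have [d d0 [N [oN Ny NV]]] : exists2 d : R, 0 < d & exists V, [/\ tau V, V (r y) &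
   forall (c' : R) z, `|c' - -1| < d -> V z -> V3 (c' *: z)].
  by apply: scalec => //; rewrite scaleN1r.
have [s [V1s Ns]] := lim x y V1 N Cx Cy oV1 oN V1x Ny.
rewrite (_ : r y = T s x + ((T s y - T s x) + (r y + -1 *: T s y))); last first.
  by rewrite scaleN1r addrA [T s x + (_ - _)]addrC subrK addrC subrK.
apply: VWU => //; apply: VW2; first by apply: VB => //; apply: V'V.
by apply: WV3 => //; apply: NV => //; rewrite subrr normr0.
Qed.

Theorem theorem4p4 (R : realType) (X : completeNormedModType R)
  (tau : set (set X)) (C : set X)
  (S : topologicalType) (mul : S -> S -> S) (T : S -> X -> X) :
  hausdorff_linear_topology tau ->
  convex_subset C -> norm_bounded C -> tau_compact tau C ->
  semitopological_semigroup mul ->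
  left_reversible mul \/ left_amenable R mul ->
  (* representation of S on C *)
  (forall s, maps_into C C (T s)) ->
  (forall s t x, C x -> T (mul s t) x = T s (T t x)) ->
  (* joint continuity of (s, x) |-> T s x, C with tau *)
  (forall s x U, C x -> tau U -> U (T s x) ->
     exists2 A, nbhs s A &
       exists V, [/\ tau V, V x &
         forall t y, A t -> V y -> C y -> U (T t y)]) ->
  (* the semigroup {T_s} is generated by averaged affine mappings *)
  (exists G : set (X -> X),
     [/\ (forall g, G g -> maps_into C C g /\ averaged_affine C g),
         (forall s, exists2 l, l <> [::] & all_in G l /\
              forall x, C x -> T s x = comp_list l x) &
         (forall l, l <> [::] -> all_in G l ->
              exists s, forall x, C x -> comp_list l x = T s x)]) ->
  let Fix := [set x | C x /\ forall s, T s x = x] in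
  (exists r : X -> X,
     [/\ maps_into C Fix r, Fix `<=` r @` C, affine_on C r &
         forall x, C x -> r (r x) = r x])
  /\
  ((forall x0 B, C x0 -> tau_nbhd tau 0 B ->
      exists V, tau_nbhd tau x0 V /\
        forall s x y, V x -> C x -> V y -> C y -> B (T s x - T s y)) ->
   exists r : X -> X,
     [/\ maps_into C Fix r, Fix `<=` r @` C, affine_on C r,
         (forall x, C x -> r (r x) = r x) &
         tau_continuous_on tau C r]).
Proof.
move=> htau cC bC cptC Ssg revam TC TM Tcont [G [avG Tgen _]] Fix.
(* For empty [S] all of [C] is fixed and the identity serves. *)
have [[s0 _]|S0] := pselect (exists s : S, True); last first.
  have idF : maps_into C Fix id.
    by move=> x Cx; split=> // s; case: S0; exists s.
  have Fid : Fix `<=` id @` C by move=> x [Cx _]; exists x.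
  split; first by exists id; split.
  by move=> _; exists id; split=> // x U Cx oU Ux; exists U.
have avT s : averaged_affine C (T s).
  have [l _ [Gl Tl]] := Tgen s.
  have [a [U [a01 UC aU E]]] := averaged_comp_list cC (fun g Gg => (avG g Gg).2) Gl.
  by exists a, U; split=> // x Cx; rewrite Tl // E.
have [r [rC rF raff rlim]] :=
  limit_retraction s0 htau cC bC cptC Ssg revam TC TM Tcont avT.
have Fr : Fix `<=` r @` C by move=> x [Cx Fx]; exists x => //; apply: rF.
have rr x : C x -> r (r x) = r x by move=> /rC[Crx Frx]; apply: rF.
split; first by exists r.
move=> eqc; exists r; split=> //.
exact: equicontinuous_limit_continuous htau eqc rlim.
Qed.
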